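(* Let $f:\mathbb{N}\to\mathbb{R}$ be an arithmetic function whose values do not change sign, let $S(n)=\sum_{k=1}^{n} f(k)$, and suppose that $S(n)=O(n)$ as $n\to\infty$. Then, as $n\to\infty$, $$\left(\left(\sum_{k=1}^{n} f(k)\right)^2-\sum_{k=1}^{n} f^2(k)\right)\left(\frac{1}{n(n-1)}-\frac{1}{n^2}\right)=O(1/n).$$
   Context: $f^2(k)$ means $(f(k))^2$. *)

(* Defs.v *)
From mathcomp Require Export all_boot all_order all_algebra.
From mathcomp Require Export all_classical all_reals all_analysis.

(* An arithmetic function is represented by [f : nat -> R]; only its values at
   positive arguments are meaningful, so [f 0] is left unconstrained. *)

Set Implicit Arguments.
Unset Strict Implicit.
Unset Printing Implicit Defensive.

Import Order.TTheory GRing.Theory Num.Theory.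
Import numFieldNormedType.Exports.

Local Open Scope ring_scope.

Definition constant_sign (R : realType) (f : nat -> R) : Prop :=
  (forall k : nat, (0 < k)%N -> 0 <= f k) \/
  (forall k : nat, (0 < k)%N -> f k <= 0).

Definition summatory (R : realType) (f : nat -> R) (n : nat) : R :=
  \sum_(1 <= k < n.+1) f k.

(* Main.v *)
Require Import Defs.
From mathcomp Require Import all_boot all_order all_algebra.
From mathcomp Require Import all_classical all_reals all_analysis.
From mathcomp Require Import ring lra.

(** Write [S n] for the sum of [f] up to [n].  Since [f] has constant sign,
    every cross product [f i * f j] is nonnegative, so that the sum of the
    squares is at most the square of the sum ([sum_sqr_le_sqr_sum]).  The first
    factor therefore lies between [0] and [S n ^+ 2], hence is at most
    [C ^+ 2 * n ^+ 2] as soon as [`|S n| <= C * n].  The second factor equals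
    [1 / (n ^+ 2 * (n - 1))], which is at most [2 / n ^+ 3] for [n >= 2]
    ([inv_gap_le]).  The product is thus at most [2 * C ^+ 2 / n]. *)

Import Order.TTheory GRing.Theory Num.Theory.
Import numFieldNormedType.Exports.

Local Open Scope classical_set_scope.
Local Open Scope ring_scope.

(** Expanding the square of the sum yields the squares plus cross products.
    The hypothesis is on products rather than on signs so that it covers
    nonnegative and nonpositive families at once. *)
Lemma sum_sqr_le_sqr_sum (R : realDomainType) (I : Type) (r : seq I)
    (P : pred I) (F : I -> R) :
  (forall i j, P i -> P j -> 0 <= F i * F j) ->
  \sum_(i <- r | P i) F i ^+ 2 <= (\sum_(i <- r | P i) F i) ^+ 2.
Proof.
move=> F_ge0; elim: r => [|i r IHr]; first by rewrite !big_nil expr0n.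
rewrite !big_cons; case: ifPn => // Pi.
have cross_ge0 : 0 <= F i * \sum_(j <- r | P j) F j.
  by rewrite mulr_sumr sumr_ge0 // => j Pj; exact: F_ge0.
by rewrite sqrrD -addrA lerD2l addrC ler_wpDr // mulrn_wge0.
Qed.

Lemma constant_sign_sum_sqr_le (R : realType) (f : nat -> R) (n : nat) :
  constant_sign f ->
  \sum_(1 <= k < n.+1) f k ^+ 2 <= (\sum_(1 <= k < n.+1) f k) ^+ 2.
Proof.
move=> f_sign; rewrite !big_nat; apply: sum_sqr_le_sqr_sum => i j.
move=> /andP[i_gt0 _] /andP[j_gt0 _].
by case: f_sign => f_sg; [rewrite mulr_ge0 ?f_sg | rewrite mulr_le0 ?f_sg].
Qed.

Lemma inv_gapE (R : realFieldType) (x : R) : 1 < x ->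
  (x * (x - 1))^-1 - (x ^+ 2)^-1 = (x ^+ 2 * (x - 1))^-1.
Proof. by move=> x_gt1; field; apply/andP; split; apply/eqP; lra. Qed.

(** From [x - 1 >= x / 2], valid for [x >= 2]. *)
Lemma inv_gap_le (R : realFieldType) (x : R) : 2 <= x ->
  (x * (x - 1))^-1 - (x ^+ 2)^-1 <= 2 * (x ^+ 2)^-1 * x^-1.
Proof.
move=> x_ge2; rewrite inv_gapE; last by lra.
have x_gt0 : 0 < x by lra.
have x1_gt0 : 0 < x - 1 by lra.
rewrite invfM [2 * _]mulrC -mulrA ler_wpM2l ?invr_ge0 ?sqr_ge0 //.
by rewrite ler_pdivlMr // mulrC ler_pdivrMr //; lra.
Qed.

Theorem corollary3 (R : realType) (f : nat -> R)
    (f_sign : constant_sign f)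
    (S_bigO : (summatory f : nat -> R) =O_\oo (fun n : nat => n%:R : R)) :
  (fun n : nat =>
     ((\sum_(1 <= k < n.+1) f k) ^+ 2 - \sum_(1 <= k < n.+1) f k ^+ 2) *
     ((n%:R * (n%:R - 1))^-1 - (n%:R ^+ 2)^-1) : R)
  =O_\oo (fun n : nat => n%:R^-1 : R).
Proof.
have [C C_gt0 S_le] := (eqO_exP _ _ _).1 S_bigO.
apply/eqO_exP; exists (C ^+ 2 * 2); first by rewrite mulr_gt0 ?exprn_gt0.
near=> n.
have n_ge2 : 2 <= n%:R :> R by rewrite ler_nat; near: n; exact: nbhs_infty_ge.
have n_gt0 : 0 < n%:R :> R by lra.
have : `|summatory f n| <= C * `|n%:R| by near: n.
rewrite /summatory (ger0_norm (ltW n_gt0)) => Sn_le.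
have sqr_le : (\sum_(1 <= k < n.+1) f k) ^+ 2 <= C ^+ 2 * n%:R ^+ 2.
  rewrite -exprMn -real_normK ?num_real //.
  by rewrite lerXn2r ?nnegrE // mulr_ge0 // ltW.
have Q_ge0 : 0 <= \sum_(1 <= k < n.+1) f k ^+ 2.
  by apply: sumr_ge0 => k _; exact: sqr_ge0.
have Q_le := constant_sign_sum_sqr_le R f n f_sign.
have gap_ge0 : 0 <= (n%:R * (n%:R - 1))^-1 - (n%:R ^+ 2)^-1 :> R.
  by rewrite inv_gapE ?invr_ge0 ?mulr_ge0 ?sqr_ge0 //; lra.
rewrite ger0_norm; last by rewrite mulr_ge0 // subr_ge0.
rewrite ger0_norm ?invr_ge0 ?ler0n //.
have -> : C ^+ 2 * 2 * n%:R^-1 =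
    C ^+ 2 * n%:R ^+ 2 * (2 * (n%:R ^+ 2)^-1 * n%:R^-1) :> R.
  by field; rewrite gt_eqF.
apply: ler_pM => //; [by rewrite subr_ge0 | by lra | exact: inv_gap_le].
Unshelve. all: by end_near. Qed.
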